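(* Let $X=\prod_{i\in\omega}X_i$ be a product of $T_1$-spaces. Suppose that for every neighbourhood assignment $\varphi$ for $X$, every $n\in\omega$, and every closed $n$-broom $P$ on $X$, the condition $\mathsf{RIH}(X,\varphi,n,P)$ implies that $\varphi$ is correct on $P$. Then $X$ is a D-space.
   Context: $\omega$ is the set of natural numbers (including $0$); each natural number $n$ is identified with the set $\{0,1,\ldots,n-1\}$, so $0=\varnothing$. Products of topological spaces carry the product topology. For a function $f$ and a set $S$, $f{\upharpoonright}S$ is the restriction of $f$ to $S$; so for $q=\langle q_i\rangle_{i\in\omega}\in\prod_{i\in\omega}X_i$ and $A\subseteq\omega$, $q{\upharpoonright}A=\langle q_i\rangle_{i\in A}$. Let $X=\prod_{i\in\omega}X_i$ and $A\subseteq\omega$. A set $P$ is an $A$-broom on $X$ iff $P\subseteq X$ and $p{\upharpoonright}A=q{\upharpoonright}A$ for all $p,q\in P$. A closed $n$-broom on $X$ is a closed subset of $X$ that is an $n$-broom on $X$ (with $n=\{0,\ldots,n-1\}$). A neighbourhood assignment (NA) for a space $X$ is a function $\varphi$ from $X$ to the powerset of $X$ such that $\varphi(p)$ is an open neighbourhood of $p$ for all $p\in X$. For $Y\subseteq X$, $\varphi\langle Y\rangle:=\bigcup\{\varphi(p):p\in Y\}$. The NA $\varphi$ is correct on $Y\subseteq X$ iff there is a closed discrete set $D$ in the subspace $Y$ such that $\varphi\langle D\rangle\supseteq Y$. (A set $D$ is discrete iff each $q\in D$ has an open neighbourhood $O(q)$ with $O(q)\cap D=\{q\}$.) A space $X$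 is a D-space iff for every NA $\varphi$ for $X$ there is a closed discrete set $D$ in $X$ with $\bigcup\{\varphi(p):p\in D\}= X$. For an NA $\varphi$ for $X=\prod_{i\in\omega}X_i$, $n\in\omega$, and a closed $n$-broom $P$ on $X$, the condition $\mathsf{RIH}(X,\varphi,n,P)$ means: for every natural $m>n$ and every closed $m$-broom $Q\subseteq P$ on $X$, $\varphi$ is correct on $Q$. *)

(* Defs.v *)
From mathcomp Require Import all_boot.
From mathcomp Require Import boolp classical_sets functions.
From mathcomp Require Import topology.

Set Implicit Arguments.
Unset Strict Implicit.
Unset Printing Implicit Defensive.

Local Open Scope classical_set_scope.

Definition discrete_set {T : topologicalType} (D : set T) : Prop :=
  forall q, D q -> exists O : set T, open_nbhs q O /\ O `&` D = [set q].

Definition neighbourhood_assignment {T : topologicalType}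
    (phi : T -> set T) : Prop :=
  forall p, open_nbhs p (phi p).

(* [set_type Y] is [Y] with the relative topology. *)
Definition correct_on {T : topologicalType} (phi : T -> set T) (Y : set T)
    : Prop :=
  exists D : set (set_type Y),
    [/\ closed D, discrete_set D & Y `<=` \bigcup_(q in D) phi (\val q)].

Definition D_space (T : topologicalType) : Prop :=
  forall phi : T -> set T, neighbourhood_assignment phi ->
  exists D : set T,
    [/\ closed D, discrete_set D & \bigcup_(p in D) phi p = setT].

Definition restr {X : nat -> Type} (A : set nat) (p : forall i, X i)
    : forall i : set_type A, X (\val i) :=
  fun i => p (\val i).
Arguments restr {X} A p i.

Definition broom {X : nat -> Type} (A : set nat) (P : set (forall i, X i))
    : Prop :=
  forall p q, P p -> P q -> restr A p = restr A q.

Definition closed_broom {X : nat -> topologicalType} (n : nat)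
    (P : set (prod_topology X)) : Prop :=
  closed P /\ broom `I_n P.

Definition RIH {X : nat -> topologicalType}
    (phi : prod_topology X -> set (prod_topology X)) (n : nat)
    (P : set (prod_topology X)) : Prop :=
  forall (m : nat) (Q : set (prod_topology X)),
    (n < m)%N -> closed_broom m Q -> Q `<=` P -> correct_on phi Q.

(* Main.v *)
Require Import Defs.
From mathcomp Require Import all_boot.
From mathcomp Require Import boolp classical_sets functions.
From mathcomp Require Import topology.

(** If [phi] is not correct on the whole product, which is a closed 0-broom,
    then applying the contrapositive of the hypothesis again and again gives a
    decreasing sequence of closed brooms [P 0, P 1, ...] on which [phi] fails to
    be correct, the members of [P k] sharing at least their first [k]
    coordinates ([exists_bad_broom_chain]).  Such a sequence converges: the
    shared coordinates define a point [q] all of whose neighbourhoods contain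
    some [P k], and [q] lies in every [P k] because these are closed and
    nonempty ([closed_broom_chain_cvg]).  So the open set [phi q] contains some
    [P k], and the single point [q] of [P k], a closed discrete set because the
    product is T1, shows that [phi] is correct on [P k] after all
    ([correct_on_by_one_point]). *)

Set Implicit Arguments.
Unset Strict Implicit.
Unset Printing Implicit Defensive.

Local Open Scope classical_set_scope.

Lemma accessible_prod_topology (I : eqType) (X : I -> topologicalType) :
  (forall i, accessible_space (X i)) -> accessible_space (prod_topology X).
Proof.
move=> T1X x y xy.
have [i xyi] : exists i, x i != y i.
  apply: contrapT => /forallNP same; move/eqP: xy; apply.
  by apply: functional_extensionality_dep => i; apply/eqP/negPn/negP/same.
have [A [oA /set_mem xA yA]] := T1X i _ _ xyi.
exists ((fun z : prod_topology X => z i) @^-1` A); split.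
- by apply: open_comp => // z _; exact: (@proj_continuous _ X i z).
- exact/mem_set.
- by apply/mem_set; apply: set_mem yA.
Qed.

Lemma correct_on_set0 (T : topologicalType) (phi : T -> set T) :
  correct_on phi set0.
Proof. by exists set0; split=> //; exact: closed0. Qed.

Lemma correct_on_by_one_point (T : topologicalType) (phi : T -> set T)
    (Y : set T) (q : T) :
  accessible_space T -> Y q -> Y `<=` phi q -> correct_on phi Y.
Proof.
move=> T1T Yq Yphi; pose q' : set_type Y := exist _ q (mem_set Yq).
exists [set q']; split.
- have -> : [set q'] = (\val : set_type Y -> T) @^-1` [set q].
    by apply/seteqP; split=> x /= => [->//|xq]; exact: val_inj.
  apply: preimage_closed; last exact: accessible_closed_set1.
  by move=> x _; exact: (@initial_continuous _ _ (@set_val T Y) x).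
- move=> _ ->; exists setT; split; last by rewrite setTI.
  by split=> //; exact: openT.
- by move=> x /Yphi phix; exists q'.
Qed.

(** A closed discrete set of [set_type setT] is carried to the space itself by
    the homeomorphism [lift], inverse to [\val]. *)
Lemma correct_on_setT (T : topologicalType) (phi : T -> set T) :
  correct_on phi setT ->
  exists D : set T,
    [/\ closed D, discrete_set D & \bigcup_(p in D) phi p = setT].
Proof.
pose lift x : set_type [set: T] := exist _ x (mem_set I).
have liftK (x : set_type [set: T]) : lift (\val x) = x by exact: val_inj.
have lift_cts : continuous lift.
  by apply/continuousP => _ [B oB <-]; rewrite -comp_preimage.
move=> [D [cD dD covD]]; exists (lift @^-1` D); split.
- by apply: preimage_closed => // x _; exact: lift_cts.
- move=> q /dD[O [[oO Oq] OD]]; exists (lift @^-1` O); split.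
    by split=> //; apply: open_comp => // x _; exact: lift_cts.
  apply/seteqP; split=> [x ODx|_ ->].
    have : (O `&` D) (lift x) by [].
    by rewrite OD => /(congr1 \val).
  suff : (O `&` D) (lift q) by [].
  by rewrite OD.
- apply/seteqP; split=> // x _.
  have [q Dq phiqx] := covD x I.
  by exists (\val q) => //=; rewrite liftK.
Qed.

Lemma broomE (X : nat -> Type) (A : set nat) (P : set (forall i, X i))
    (p q : forall i, X i) (i : nat) :
  broom A P -> P p -> P q -> A i -> p i = q i.
Proof.
move=> bP Pp Pq Ai.
exact: (congr1 (fun r => r (exist _ i (mem_set Ai))) (bP _ _ Pp Pq)).
Qed.

Lemma sub_broom (X : nat -> Type) (A B : set nat) (P : set (forall i, X i)) :
  A `<=` B -> broom B P -> broom A P.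
Proof.
move=> AB bP p q Pp Pq; apply: functional_extensionality_dep => i.
by apply: (broomE bP Pp Pq); apply: AB; exact: set_valP.
Qed.

Lemma closed_0broom_setT (X : nat -> topologicalType) :
  closed_broom 0 [set: prod_topology X].
Proof.
split; first exact: closedT.
move=> p q _ _; apply: functional_extensionality_dep => i.
by have := set_valP i.
Qed.

(** The sets [P k] generate a filter.  It converges in the product because its
    image under the [i]-th projection is principal at the coordinate [i] shared
    by all points of [P i.+1]. *)
Lemma closed_broom_chain_cvg (X : nat -> topologicalType)
    (P : nat -> set (prod_topology X)) :
  (forall k, closed_broom k (P k)) -> (forall k, P k !=set0) ->
  (forall j k, (j <= k)%N -> P k `<=` P j) ->
  exists2 q, (forall k, P k q) & forall U, nbhs q U -> exists k, P k `<=` U.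
Proof.
move=> cbP P0 decP; have [p Pp] := choice P0.
(* Rank [i.+1] is the first one for which coordinate [i] is shared. *)
pose q : prod_topology X := fun i => p i.+1 i.
have Pq k x i : (i < k)%N -> P k x -> x i = q i.
  move=> ik /(decP _ _ ik) Px.
  by apply: (broomE (cbP i.+1).2 Px (Pp _)) => /=.
have F : Filter (filter_from setT P).
  apply: filter_from_filter; first by exists 0.
  move=> j k _ _; exists (maxn j k) => //.
  by rewrite subsetI; split; apply: decP; rewrite ?leq_maxl ?leq_maxr.
have cvgq : filter_from setT P --> q.
  apply/cvg_sup => i U [_ [[W oW <-] Wq] WU].
  exists i.+1 => // x /(Pq _ _ _ (leqnn _)) xq.
  by apply: WU; rewrite /= xq.
have nbhsq U : nbhs q U -> exists k, P k `<=` U.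
  by move=> /cvgq[k _ PU]; exists k.
exists q => // k; apply: (cbP k).1 => U /nbhsq[l PU].
exists (p (maxn k l)); split; first by apply: decP (Pp _); rewrite leq_maxl.
by apply/PU/(decP _ _ _ _ (Pp _)); rewrite leq_maxr.
Qed.

(** On a bad [n]-broom the hypothesis [RIH] must fail, and a failure is a bad
    [m]-broom inside it with [n < m].  The ranks of the brooms chosen in this way
    increase strictly, so the [k]-th rank is at least [k] and the [k]-th set is
    in particular a [k]-broom. *)
Lemma exists_bad_broom_chain (X : nat -> topologicalType)
    (phi : prod_topology X -> set (prod_topology X)) :
  (forall n P, closed_broom n P -> RIH phi n P -> correct_on phi P) ->
  ~ correct_on phi setT ->
  exists P : nat -> set (prod_topology X),
    [/\ forall k, closed_broom k (P k), forall k, ~ correct_on phi (P k) &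
        forall j k, (j <= k)%N -> P k `<=` P j].
Proof.
move=> H bad; pose B (s : nat * set (prod_topology X)) :=
  closed_broom s.1 s.2 /\ ~ correct_on phi s.2.
pose R (s t : {s | B s}) :=
  ((sval s).1 < (sval t).1)%N /\ (sval t).2 `<=` (sval s).2.
have step s : {t | R s t}.
  apply: cid; case: s => -[n P] /= [cbP badP]; apply: contrapT => noR.
  apply: (badP); apply: (H _ _ cbP) => m Q nm cbQ QP; apply: contrapT => badQ.
  by apply: noR; exists (exist _ (m, Q) (conj cbQ badQ)).
have [f [_ fR]] := dependent_choice step
  (exist B (0, setT) (conj (@closed_0broom_setT X) bad)).
have f_ge k : (k <= (sval (f k)).1)%N.
  by elim: k => // k IH; apply: leq_ltn_trans IH (fR k).1.
exists (fun k => (sval (f k)).2); split=> [k|k|].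
- have [[cP bP] _] := svalP (f k); split=> //.
  by apply: sub_broom bP => i /= ik; exact: leq_trans ik (f_ge k).
- by have [] := svalP (f k).
- move=> j k /subnK <-; elim: (k - j) => // d IH.
  exact: subset_trans (fR _).2 IH.
Qed.

Theorem theorem5 (X : nat -> topologicalType)
    (T1X : forall i : nat, accessible_space (X i))
    (H : forall phi : prod_topology X -> set (prod_topology X),
       neighbourhood_assignment phi ->
       forall (n : nat) (P : set (prod_topology X)),
         closed_broom n P -> RIH phi n P -> correct_on phi P) :
  D_space (prod_topology X).
Proof.
move=> phi NAphi; apply: correct_on_setT; apply: contrapT => bad.
have [P [cbP badP decP]] := exists_bad_broom_chain (H phi NAphi) bad.
have P0 k : P k !=set0.
  apply/set0P/eqP => Pk0; apply: (badP k); rewrite Pk0.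
  exact: correct_on_set0.
have [q Pq nbhsq] := closed_broom_chain_cvg cbP P0 decP.
have [k Pphi] := nbhsq _ (open_nbhs_nbhs (NAphi q)).
apply: (badP k); apply: correct_on_by_one_point (Pq k) Pphi.
exact: accessible_prod_topology.
Qed.
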